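(* If a family $\mathcal{O}$ of $n$ (not necessarily distinct) odd cycles in the complete graph $K_{n+1}$ has no rainbow odd cycle, then $\mathcal{O}$ is a pruned cactus.
   Context: A cycle is regarded as its set of edges; $\bigcup\mathcal{O}$ denotes the graph formed by the union of the edge sets of the members of $\mathcal{O}$. A family means a multiset (repetitions allowed). Given a family $\mathcal{E}$ of edge sets, an $\mathcal{E}$-rainbow set is a set $R\subseteq\bigcup\mathcal{E}$ together with an injection $\sigma:R\to\mathcal{E}$ with $e\in\sigma(e)$ for all $e\in R$. A rainbow odd cycle is a rainbow set forming a cycle of odd length. Pruned cactus (recursive definition): a family $\mathcal{O}$ of cycles is a pruned cactus if either all cycles in $\mathcal{O}$ are identical to one cycle on $|\mathcal{O}|+1$ vertices, or $\mathcal{O}$ can be partitioned into two pruned cacti $\mathcal{O}_1,\mathcal{O}_2$ such that the graphs $\bigcup\mathcal{O}_1$ and $\bigcup\mathcal{O}_2$ share exactly one vertex. *)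

(* Defs.v *)
From mathcomp Require Import all_boot.

Set Implicit Arguments.
Unset Strict Implicit.
Unset Printing Implicit Defensive.

(* Edges of the complete graph on V are two-element sets of vertices.  A
   multiset of edge sets is represented by a sequence, considered up to
   [perm_eq]; repeated members are distinguished by their positions. *)

Definition is_cycle (V : finType) (C : {set {set V}}) : Prop :=
  exists p : seq V,
    [/\ uniq p, 2 < size p & C = [set [set x; next p x] | x in p]].

Definition is_odd_cycle (V : finType) (C : {set {set V}}) : Prop :=
  is_cycle C /\ odd #|C|.

Definition union_graph (V : finType) (O : seq {set {set V}}) : {set {set V}} :=
  \bigcup_(C <- O) C.

(* The injection into the family is an injection into its positions, so that
   equal members may be used as often as they are repeated. *)
Definition rainbow (V : finType) (O : seq {set {set V}}) (R : {set {set V}})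
    : Prop :=
  R \subset union_graph O /\
  exists sigma : {set V} -> nat,
    {in R &, injective sigma} /\
    (forall e, e \in R -> sigma e < size O /\ e \in nth set0 O (sigma e)).

Definition has_rainbow_odd_cycle (V : finType) (O : seq {set {set V}}) : Prop :=
  exists R : {set {set V}}, is_odd_cycle R /\ rainbow O R.

(* [cover E] is the vertex set of the graph with edge set E. *)
Inductive pruned_cactus (V : finType) : seq {set {set V}} -> Prop :=
| pruned_cactus_cycle (O : seq {set {set V}}) (C : {set {set V}}) :
    is_cycle C -> #|cover C| = (size O).+1 ->
    (forall D, D \in O -> D = C) ->
    pruned_cactus O
| pruned_cactus_join (O O1 O2 : seq {set {set V}}) :
    perm_eq O (O1 ++ O2) ->
    pruned_cactus O1 -> pruned_cactus O2 ->
    #|cover (union_graph O1) :&: cover (union_graph O2)| = 1 ->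
    pruned_cactus O.

(* Main.v *)
(* Over F_2, a 2-colouring g of the vertices gives every edge the sum of the
   colours of its ends, so that g is proper on an edge exactly when this
   value is 1; an odd cycle always has an edge of value 0. Picking one edge
   t_i from every cycle O_i with as few proper 2-colourings as possible
   yields a rainbow spanning tree, in the guise of a common proper
   2-colouring chi and of 2-colourings h_i separating the ends of t_i and of
   no other t_j. An edge e has coordinates (h_k e)_k, which are its tree
   path, and is negative if it closes an odd cycle with that path. If edges
   from distinct cycles O_i (i in A) sum to zero in the coordinates of A,
   then an even number of them is negative.

   Call i and j linked if the negative edges of O_i and O_j have both i and
   j on their tree paths. Since O_i is a cycle, none of its proper nonempty
   subsets meets every vertex evenly, and this forces every i to be linked
   to some j. Then an edge of O_i and an edge of O_j that agree and do not
   both vanish in the coordinates i and j are equal: otherwise the seven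
   nonzero vectors of some three coordinates would all be edges, a Fano
   plane, which the laminarity of the cuts excludes. Hence O_i consists of
   tree edges and of one negative edge closing their path, and O_l = O_i for
   every t_l in O_i. The blocks obtained in this way are glued one at a
   time: the tree being connected, the next block touches the current union,
   and the number of tree edges leaves them only one common vertex. *)

Require Import Defs.
From mathcomp Require Import all_boot zify.

Set Implicit Arguments.
Unset Strict Implicit.
Unset Printing Implicit Defensive.

(** * Cuts *)

Section Cuts.
Variable V : finType.
Implicit Types (g : V -> bool) (e : {set V}) (x y : V).

Definition cut g e : bool := \big[addb/false]_(x in e) g x.

Lemma cut2 g x y : x != y -> cut g [set x; y] = g x (+) g y.
Proof. by move=> nxy; rewrite /cut big_setU1 ?big_set1 // inE. Qed.

Lemma eq_cut_in g1 g2 e : {in e, g1 =1 g2} -> cut g1 e = cut g2 e.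
Proof. by move=> eg; apply: eq_bigr. Qed.

Lemma cutD g1 g2 e : cut (fun x => g1 x (+) g2 x) e = cut g1 e (+) cut g2 e.
Proof. exact: big_split. Qed.

Lemma cutM b g e : cut (fun x => b && g x) e = b && cut g e.
Proof. by case: b => //=; rewrite /cut big1. Qed.

Lemma cut_sum (I : finType) (A : pred I) (h : I -> V -> bool) e :
  cut (fun x => \big[addb/false]_(i | A i) h i x) e =
  \big[addb/false]_(i | A i) cut (h i) e.
Proof. exact: exchange_big. Qed.

Lemma cut_pred1 x e : cut (pred1 x) e = (x \in e).
Proof.
rewrite /cut; case: (boolP (x \in e)) => xe; last first.
  by rewrite big1 // => y ye; apply: contraNF xe => /eqP <-.
by rewrite (bigD1 x) //= eqxx big1 // => y /andP[_ /negPf].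
Qed.

Lemma cutNP g e :
  #|e| = 2 -> reflect {in e &, forall x y, g x = g y} (~~ cut g e).
Proof.
move=> e2; apply: (iffP idP); have /eqP/cards2P[a [b [nab ->]]] := e2.
  rewrite cut2 // negb_add => /eqP gab x y.
  by rewrite !inE => /orP[]/eqP-> /orP[]/eqP->.
by move=> ge; rewrite cut2 // negb_add (ge a b) // !inE eqxx ?orbT.
Qed.

Lemma cut_const b e : #|e| = 2 -> cut (fun=> b) e = false.
Proof. by move=> e2; apply/negbTE/cutNP. Qed.

End Cuts.

(** * Cycles *)

Section Cycles.
Variable V : finType.
Implicit Types (g : V -> bool) (e : {set V}) (C D R : {set {set V}}).
Implicit Types (p : seq V) (x y : V).

Lemma next_neq p x : uniq p -> 1 < size p -> x \in p -> next p x != x.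
Proof.
move=> Up szp xp; have [i q Eq] := rot_to xp.
have Uq : uniq (x :: q) by rewrite -Eq rot_uniq.
rewrite -(next_rot i Up) Eq; case: q Uq Eq => [|y q] Uq Eq.
  by move: szp; rewrite -(size_rot i) Eq.
by rewrite /= eqxx; move: Uq; rewrite /= inE negb_or eq_sym => /andP[/andP[]].
Qed.

Lemma next_next_neq p x :
  uniq p -> 2 < size p -> x \in p -> next p (next p x) != x.
Proof.
move=> Up szp xp; have [i q Eq] := rot_to xp.
have Uq : uniq (x :: q) by rewrite -Eq rot_uniq.
rewrite -!(next_rot i Up) Eq; case: q Uq Eq => [|y [|z q]] Uq Eq;
  try by move: szp; rewrite -(size_rot i) Eq.
move: Uq; rewrite /= !inE !negb_or => /andP[/and3P[nxy nxz _] _].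
by rewrite eqxx [y == x]eq_sym (negPf nxy) eqxx eq_sym.
Qed.

Lemma next_closed p (P : pred V) x : uniq p -> x \in p -> P x ->
  {in p, forall y, P y -> P (next p y)} -> {in p, forall y, P y}.
Proof.
move=> Up xp Px clP y yp.
have /iter_findex <- : fconnect (next p) x y
  by rewrite (fconnect_cycle (cycle_next Up) xp).
elim: (findex _ _ _) => //= k IH; apply: (clP) => //.
by elim: k {IH} => //= k IH; rewrite mem_next.
Qed.

Lemma next_edge_inj p : uniq p -> 2 < size p ->
  {in p &, injective (fun x => [set x; next p x])}.
Proof.
move=> Up szp x y xp yp exy.
have: x \in [set y; next p y] by rewrite -exy !inE eqxx.
have: y \in [set x; next p x] by rewrite exy !inE eqxx.
rewrite !inE => /orP[/eqP->//|/eqP Ey] /orP[/eqP//|/eqP Ex].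
by move: (next_next_neq Up szp xp); rewrite -Ey -Ex eqxx.
Qed.

Lemma card_next_edges p : uniq p -> 2 < size p ->
  #|[set [set x; next p x] | x in p]| = size p.
Proof.
move=> Up szp; rewrite card_in_imset; first exact/card_uniqP.
exact: next_edge_inj.
Qed.

Lemma cycle_edge_card C e : is_cycle C -> e \in C -> #|e| = 2.
Proof.
case=> p [Up szp ->] /imsetP[x xp ->].
by rewrite cards2 eq_sym next_neq // ltnW.
Qed.

Lemma card_cover_cycle C : is_cycle C -> #|cover C| = #|C|.
Proof.
case=> p [Up szp ->]; rewrite card_next_edges // -(card_uniqP Up).
apply: eq_card => x; apply/bigcupP/idP => [[e /imsetP[y yp ->]]|xp].
  by rewrite !inE => /orP[/eqP->|/eqP->] //; rewrite mem_next.
by exists [set x; next p x]; [apply: imset_f | rewrite !inE eqxx].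
Qed.

Lemma cycle_cut_even C g :
  is_cycle C -> \big[addb/false]_(e in C) cut g e = false.
Proof.
case=> p [Up szp ->]; rewrite big_imset /=; last exact: next_edge_inj.
rewrite (eq_bigr (fun x => g x (+) g (next p x))) => [|x xp]; last first.
  by rewrite cut2 // eq_sym next_neq // ltnW.
rewrite big_split /= (reindex_inj (can_inj (prev_next Up))) /=.
by rewrite (eq_bigl (fun x => x \in p)) ?addbb // => x; rewrite /= mem_next.
Qed.

Lemma cycle_even_subset C D : is_cycle C -> D \subset C -> D != set0 ->
  (forall x, \big[addb/false]_(e in D) (x \in e) = false) -> D = C.
Proof.
case=> p [Up szp ->] sDC /set0Pn[e eD] even.
have /imsetP[x xp Ee] := subsetP sDC e eD.
suff all_in : {in p, forall y, [set y; next p y] \in D}.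
  apply/eqP; rewrite eqEsubset sDC; apply/subsetP=> _ /imsetP[y yp ->].
  exact: all_in.
apply: (next_closed Up xp) => [|y yp yD]; first by rewrite -Ee.
apply: contraT => nyD; have := even (next p y).
rewrite (bigD1 [set y; next p y]) //= set22 big1 // => f /andP[fD nfy].
have /imsetP[z zp Ef] := subsetP sDC f fD; rewrite {f}Ef in fD nfy *.
rewrite !inE; apply/norP; split.
  by apply: contraNneq nyD => ->.
by apply: contraNneq nfy => /(can_inj (prev_next Up)) ->.
Qed.

Lemma odd_cycle_cut C g : is_odd_cycle C -> exists2 e, e \in C & ~~ cut g e.
Proof.
case=> cycC oddC; apply/exists_inP; apply: contraLR oddC.
rewrite negb_exists_in => /forall_inP cutC.
suff -> : odd #|C| = \big[addb/false]_(e in C) cut g e.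
  by rewrite cycle_cut_even.
rewrite (eq_bigr (fun=> true)) => [|e /cutC]; last by rewrite negbK.
by rewrite big_const; elim: #|C| => //= k ->.
Qed.

Definition adjacent R : rel V := fun x y => [set x; y] \in R.

Lemma adjacent_sym R : connect_sym (adjacent R).
Proof. by apply: sym_connect_sym => x y; rewrite /adjacent setUC. Qed.

Lemma proper_path_last R g x p : {in R, forall e, #|e| = 2} ->
  {in R, forall e, cut g e} -> path (adjacent R) x p ->
  g (last x p) = g x (+) odd (size p).
Proof.
move=> R2 gR; elim: p x => [|y p IH] x /=; first by rewrite addbF.
case/andP=> xyR /IH->; have := gR _ xyR; have := R2 _ xyR.
rewrite cards2; case: eqVneq => // nxy _; rewrite cut2 //.
by case: (g x); case: (g y); case: odd.
Qed.

Lemma odd_cycle_through_edge R g x y : {in R, forall e, #|e| = 2} ->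
  {in R, forall e, cut g e} -> x != y -> g x = g y ->
  connect (adjacent R) x y ->
  exists2 C : {set {set V}}, C \subset [set x; y] |: R & is_odd_cycle C.
Proof.
move=> R2 gR nxy gxy /connectP[p0 /shortenP[p Rp Up _] Ey].
have even_p : ~~ odd (size p).
  move: (proper_path_last R2 gR Rp); rewrite -Ey gxy.
  by case: (g y); case: odd.
have szp : 2 < size (x :: p).
  case: p Rp Ey even_p {Up} => [|z [|z' p]] //= _ Ey.
  by rewrite Ey eqxx in nxy.
exists [set [set z; next (x :: p) z] | z in x :: p].
  apply/subsetP=> _ /imsetP[z zp ->].
  suff cyc : cycle (adjacent ([set x; y] |: R)) (x :: p).
    exact: (next_cycle cyc zp).
  rewrite /= rcons_path -Ey; apply/andP; split; last first.
    by rewrite /adjacent [[set y; x]]setUC setU11.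
  by apply: sub_path Rp => u v uvR; apply: setU1r.
by split; [exists (x :: p) | rewrite card_next_edges //= even_p].
Qed.

Lemma proper_colouring_add_edge R g x y : {in R, forall e, #|e| = 2} ->
  {in R, forall e, cut g e} -> x != y ->
  (g x = g y -> ~~ connect (adjacent R) x y) ->
  exists g', {in [set x; y] |: R, forall e, cut g' e}.
Proof.
move=> R2 gR nxy.
have [gxy /(_ gxy) nRxy|gxy _] := eqVneq (g x) (g y); last first.
  exists g => e /setU1P[->|/gR//]; rewrite cut2 //.
  by move: gxy; case: (g x); case: (g y).
exists (fun z => g z (+) connect (adjacent R) x z) => e /setU1P[->|eR].
  by rewrite cut2 // connect0 (negPf nRxy) gxy; case: (g y).
rewrite cutD gR //; apply/(cutNP _ (R2 e eR)) => u v ue ve.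
have [->//|nuv] := eqVneq u v; apply: same_connect_r; first exact: adjacent_sym.
apply: connect1; rewrite /adjacent; suff -> : [set u; v] = e by [].
by apply/eqP; rewrite eqEcard R2 // cards2 nuv subUset !sub1set ue ve.
Qed.

Lemma bipartite_of_no_odd_cycle R : {in R, forall e, #|e| = 2} ->
  (forall C, C \subset R -> ~ is_odd_cycle C) ->
  exists g, {in R, forall e, cut g e}.
Proof.
have [k] := ubnP #|R|; elim: k R => // k IH R; rewrite ltnS => leRk R2 noC.
have [->|[e eR]] := set_0Vmem R.
  by exists (fun=> false) => e; rewrite inE.
have R'2 : {in R :\ e, forall f : {set V}, #|f| = 2} by move=> f /setD1P[_ /R2].
have [|//||g gR] := IH (R :\ e).
- by rewrite (leq_trans _ leRk) // [X in _ < X](cardsD1 e) eR.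
- by move=> C sCR; apply: noC; apply: subset_trans sCR (subsetDl _ _).
have /eqP/cards2P[x [y [nxy Ee]]] := R2 e eR.
have ER : [set x; y] |: (R :\ e) = R by rewrite -Ee setD1K.
rewrite -ER; apply: (proper_colouring_add_edge R'2 gR nxy) => gxy.
apply/negP => /(odd_cycle_through_edge R'2 gR nxy gxy)[C].
by rewrite ER => /noC.
Qed.

End Cycles.

(** * Spanning trees and the cuts of their edges *)

Section SpanningTree.
Variables (V I : finType) (t : I -> {set V}) (h : I -> V -> bool).
Hypothesis cardV : #|V| = #|I|.+1.
Hypothesis t2 : forall i, #|t i| = 2.
Hypothesis th : forall i j, cut (h i) (t j) = (i == j).
Implicit Types (e f : {set V}) (g : V -> bool) (i j k l : I).

Lemma big_dual_cut (A : pred I) i :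
  \big[addb/false]_(l | A l) cut (h l) (t i) = A i.
Proof.
case: (boolP (A i)) => Ai; last first.
  by apply: big1 => l Al; rewrite th; apply: contraNF Ai => /eqP <-.
by rewrite (bigD1 i) //= th eqxx big1 // => l /andP[_ /negPf]; rewrite th.
Qed.

(* The 2^(|L| + 1) affine combinations of the [h l] with [l] in [L] are
   already distinct on X. *)
Lemma card_tree_edges (L : {set I}) (X : {set V}) :
  X != set0 -> {in L, forall l, t l \subset X} -> #|L| < #|X|.
Proof.
case/set0Pn=> x0 x0X tX.
pose G (Ac : {set I} * bool) x := Ac.2 (+) \big[addb/false]_(l in Ac.1) h l x.
pose F Ac := [set x in X | G Ac x].
have cutG Ac l : cut (G Ac) (t l) = (l \in Ac.1).
  by rewrite cutD cut_const // cut_sum big_dual_cut.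
suff Finj : {in setX (powerset L) [set: bool] &, injective F}.
  have sF : F @: setX (powerset L) [set: bool] \subset powerset X.
    apply/subsetP=> _ /imsetP[Ac _ ->]; rewrite inE; apply/subsetP=> x.
    by rewrite inE => /andP[].
  have := subset_leq_card sF; rewrite card_in_imset // cardsX !card_powerset.
  by rewrite cardsT card_bool -expnSr leq_exp2l.
case=> [A c] [A' c']; rewrite !inE !andbT /= => sA sA' eF.
have eG x : x \in X -> G (A, c) x = G (A', c') x.
  by move=> xX; have /setP/(_ x) := eF; rewrite !inE xX.
have eA : A = A'.
  apply/setP=> l; case: (boolP (l \in L)) => lL; last first.
    by rewrite (contraNF (subsetP sA l) lL) (contraNF (subsetP sA' l) lL).
  rewrite -(cutG (A, c) l) -(cutG (A', c') l); apply: eq_cut_in => x xl.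
  exact/eG/(subsetP (tX l lL)).
by move: (eG x0 x0X); rewrite eA /G /= => /addIb ->.
Qed.

Lemma tree_connected g : (forall i, ~~ cut g (t i)) -> forall x y, g x = g y.
Proof.
move=> gt x y; apply/eqP; apply: contraT => gxy.
pose X := [set z | g z == g x]; pose L := [set i | t i \subset X].
have ltL : #|L| < #|X|.
  apply: card_tree_edges => [|l]; last by rewrite inE.
  by apply/set0Pn; exists x; rewrite inE.
have ltLC : #|~: L| < #|~: X|.
  apply: card_tree_edges => [|l].
    by apply/set0Pn; exists y; rewrite !inE eq_sym.
  rewrite !inE => /subsetPn[a al naX]; apply/subsetP=> b bl.
  by move: naX; rewrite !inE (cutNP _ (t2 l) (gt l) a b).
have := leq_add ltL ltLC.
by rewrite addSn addnS cardsC cardsC cardV ltnn.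
Qed.

Lemma cut_expand g e : #|e| = 2 ->
  cut g e = \big[addb/false]_l (cut g (t l) && cut (h l) e).
Proof.
move=> e2; pose g' x := g x (+) \big[addb/false]_(l | cut g (t l)) h l x.
have g'c : forall x y, g' x = g' y.
  by apply: tree_connected => i; rewrite cutD cut_sum big_dual_cut addbb.
have : ~~ cut g' e by apply/cutNP => // x y _ _.
rewrite cutD cut_sum big_mkcond /= negb_add => /eqP->.
by apply: eq_bigr => l _; case: (cut g _).
Qed.

Lemma edge_eq e f : #|e| = 2 -> #|f| = 2 ->
  (forall l, cut (h l) e = cut (h l) f) -> e = f.
Proof.
move=> e2 f2 ef; apply/setP=> x; rewrite -!cut_pred1 !cut_expand //.
by apply: eq_bigr => l _; rewrite ef.
Qed.

Lemma vertex_eq x y : (forall l, h l x = h l y) -> x = y.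
Proof.
move=> hxy; apply/eqP; apply: contraT => nxy.
have e2 : #|[set x; y]| = 2 by rewrite cards2 nxy.
have := cut_pred1 x [set x; y]; rewrite set21 cut_expand // big1 // => l _.
by rewrite cut2 // hxy addbb andbF.
Qed.

Lemma edge_crosses e : #|e| = 2 -> exists l, cut (h l) e.
Proof.
move=> e2; have /eqP/cards2P[x [y [nxy Ee]]] := e2.
apply/existsP; apply: contraNT nxy; rewrite negb_exists => /forallP none.
apply/eqP/vertex_eq => l; apply: (cutNP _ e2 (none l)).
  by rewrite Ee set21.
by rewrite Ee set22.
Qed.

(* The product of two coordinates is not affine on the whole of F_2^2. *)
Lemma cut_laminar i k :
  i != k -> exists c : bool * bool, forall x, (h i x, h k x) != c.
Proof.
move=> nik; case: (boolP [exists c, forall x, (h i x, h k x) != c]).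
  by case/existsP=> c /forallP; exists c.
rewrite negb_exists => /forallP full.
have {}full c d : exists2 x, h i x = c & h k x = d.
  have /forallPn[x] := full (c, d); rewrite negbK => /eqP[<- <-].
  by exists x.
pose g x := h i x && h k x.
pose g' x := g x (+) (cut g (t i) && h i x) (+) (cut g (t k) && h k x).
have g'c : forall x y, g' x = g' y.
  apply: tree_connected => l; rewrite !cutD !cutM !th.
  have [<-|nil] := eqVneq i l.
    by rewrite [k == i]eq_sym (negPf nik) andbF andbT addbF addbb.
  have [<-|nkl] := eqVneq k l; first by rewrite andbF andbT addbF addbb.
  rewrite !andbF !addbF; apply/cutNP => // x y xl yl.
  by rewrite /g !(cutNP _ (t2 l) _ x y) ?th.
have [[x00 i00 k00] [x01 i01 k01]] := (full false false, full false true).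
have [[x10 i10 k10] [x11 i11 k11]] := (full true false, full true true).
move: (g'c x00 x01) (g'c x00 x10) (g'c x00 x11).
rewrite /g' /g i00 k00 i01 k01 i10 k10 i11 k11.
by case: (cut _ (t i)); case: (cut _ (t k)).
Qed.

Lemma crossing_same_side i k e f x y : i != k -> #|e| = 2 -> #|f| = 2 ->
  cut (h i) e -> ~~ cut (h k) e -> cut (h i) f -> ~~ cut (h k) f ->
  x \in e -> y \in f -> h k x = h k y.
Proof.
move=> nik e2 f2 ei ek fi fk xe yf; have [[c d] quad] := cut_laminar nik.
suff side (a : {set V}) z :
    #|a| = 2 -> cut (h i) a -> ~~ cut (h k) a -> z \in a -> h k z = ~~ d.
  by rewrite (side e x) ?(side f y).
move=> a2 ai ak za; have [u ua /eqP hu] : exists2 u, u \in a & h i u == c.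
  apply/exists_inP; move: ai; apply: contraLR.
  rewrite negb_exists_in => /forall_inP away; apply/(cutNP _ a2) => u v ua va.
  move: (away u ua) (away v va).
  by case: (h i u); case: (h i v); case: c {quad away}.
move: (quad u); rewrite xpair_eqE hu eqxx (cutNP _ a2 ak z u) //=.
by case: (h k u); case: d {quad}.
Qed.

Lemma cuts_nested i k x y : i != k -> h i x (+) h i y -> h k x (+) h k y ->
  (forall z, h i z != h i x -> h k z != h k x) \/
  (forall z, h k z != h k x -> h i z != h i x).
Proof.
move=> nik ixy kxy; have [c quad] := cut_laminar nik.
have [cix|cix] := eqVneq c.1 (h i x); [right|left] => z;
  move: (quad x) (quad y) (quad z) cix ixy kxy; case: c {quad} => c d;
  rewrite !xpair_eqE /=; case: (h i x) (h i y) (h k x) (h k y) => -[] [] [];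
  by case: (h i z); case: (h k z); case: c; case: d.
Qed.

(* Seen from an end of the edge crossing all three cuts, these form a chain, and
   an edge crossing the outer two crosses the middle one. *)
Lemma no_fano_edges i j k (e_ij e_ik e_jk e : {set V}) :
  i != j -> i != k -> j != k ->
  #|e_ij| = 2 -> #|e_ik| = 2 -> #|e_jk| = 2 -> #|e| = 2 ->
  (cut (h i) e_ij, cut (h j) e_ij, cut (h k) e_ij) = (true, true, false) ->
  (cut (h i) e_ik, cut (h j) e_ik, cut (h k) e_ik) = (true, false, true) ->
  (cut (h i) e_jk, cut (h j) e_jk, cut (h k) e_jk) = (false, true, true) ->
  (cut (h i) e, cut (h j) e, cut (h k) e) = (true, true, true) -> False.
Proof.
move=> nij nik njk ij2 ik2 jk2 /eqP/cards2P[x [y [nxy ->]]].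
rewrite !cut2 // => -[iji ijj ijk] [iki ikj ikk] [jki jkj jkk] [xyi xyj xyk].
pose below a b := forall z, h a z != h a x -> h b z != h b x.
have middle a b c (f : {set V}) : #|f| = 2 -> below a b -> below b c ->
    cut (h a) f -> cut (h c) f -> cut (h b) f = true.
  move=> /eqP/cards2P[u [v [nuv ->]]] ab bc; rewrite !cut2 //.
  move: (ab u) (ab v) (bc u) (bc v).
  case: (h a u) (h a v) (h a x) => -[] [];
    case: (h b u) (h b v) (h b x) => -[] [];
    by case: (h c u) (h c v) (h c x) => -[] [].
have [ij|ji] := cuts_nested nij xyi xyj;
  have [jk|kj] := cuts_nested njk xyj xyk;
  have [ik|ki] := cuts_nested nik xyi xyk.
- by rewrite (middle i j k e_ik) in ikj.
- by rewrite (middle i j k e_ik) in ikj.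
- by rewrite (middle i k j e_ij) in ijk.
- by rewrite (middle k i j e_jk) in jki.
- by rewrite (middle j i k e_jk) in jki.
- by rewrite (middle j k i e_ij) in ijk.
- by rewrite (middle k j i e_ik) in ikj.
- by rewrite (middle k j i e_ik) in ikj.
Qed.

End SpanningTree.

(** * Rainbow spanning trees *)

Section Transversals.
Variables (V I : finType) (O : I -> {set {set V}}).
Hypothesis Oodd : forall i, is_odd_cycle (O i).

Definition transversal (s : I -> {set V}) := forall i, s i \in O i.

Hypothesis Obipartite :
  forall s, transversal s -> exists g : V -> bool, forall i, cut g (s i).

Definition proper_colourings (s : I -> {set V}) : {set {ffun V -> bool}} :=
  [set g : {ffun V -> bool} | [forall i, cut g (s i)]].

Lemma exists_min_transversal : exists s, transversal s /\
  forall s', transversal s' ->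
    #|proper_colourings s| <= #|proper_colourings s'|.
Proof.
have [s sO] : exists s, transversal s.
  apply: (@fin_all_exists _ (fun=> {set V}) (fun i e => e \in O i)) => i.
  by have [e eO _] := odd_cycle_cut (fun=> false) (Oodd i); exists e.
pose P k := [exists u : {ffun I -> {set V}},
  [forall i, u i \in O i] && (#|proper_colourings u| == k)].
have PT s' : transversal s' -> P #|proper_colourings s'|.
  move=> s'O; apply/existsP; exists [ffun i => s' i]; apply/andP; split.
    by apply/forallP=> i; rewrite ffunE.
  apply/eqP/eq_card => g; rewrite !inE; apply: eq_forallb => i.
  by rewrite ffunE.
have exP : exists k, P k by exists #|proper_colourings s|; apply: PT.
case: (ex_minnP exP) => k /existsP[u /andP[/forallP uO /eqP <-]] kmin.
by exists u; split=> // s' /PT; apply: kmin.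
Qed.

(* Otherwise replacing [s i] by an edge of [O i] on which some proper colouring
   of [s] fails would leave fewer proper colourings. *)
Lemma min_transversal_separates s i : transversal s ->
  (forall s', transversal s' ->
     #|proper_colourings s| <= #|proper_colourings s'|) ->
  exists g : V -> bool, forall j, cut g (s j) = (j != i).
Proof.
move=> sO smin; have [chi chiP] := Obipartite sO.
have [e eO ce] := odd_cycle_cut chi (Oodd i).
pose s' j := if j == i then e else s j.
have s'O : transversal s' by move=> j; rewrite /s'; case: eqP => [->|].
have : ~~ (proper_colourings s' \proper proper_colourings s).
  by apply: contraL (smin s' s'O) => /proper_card; rewrite -ltnNge.
rewrite properE negb_and negbK => /orP[/subsetPn[g]|/subsetP sub].
  rewrite !inE => /forallP gs' /forallPn[k gk]; exists g => j.
  have gs l : l != i -> cut g (s l).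
    by move=> li; have := gs' l; rewrite /s' (negPf li).
  have [->|/gs //] := eqVneq j i.
  by have [<-|/gs gk'] := eqVneq k i; [apply: negbTE | rewrite gk' in gk].
have : [ffun x => chi x] \in proper_colourings s'.
  apply: sub; rewrite inE; apply/forallP=> j.
  by rewrite (eq_cut_in (in1W (ffunE chi))).
rewrite inE => /forallP/(_ i); rewrite (eq_cut_in (in1W (ffunE chi))).
by rewrite /s' eqxx (negPf ce).
Qed.

Lemma exists_rainbow_tree :
  exists (t : I -> {set V}) (chi : V -> bool) (h : I -> V -> bool),
  [/\ transversal t, forall i, cut chi (t i)
    & forall i j, cut (h i) (t j) = (i == j)].
Proof.
have [t [tO tmin]] := exists_min_transversal; have [chi tchi] := Obipartite tO.
have [g gt] := @fin_all_exists _ (fun=> V -> bool)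
  (fun i g => forall j, cut g (t j) = (j != i))
  (fun i => min_transversal_separates i tO tmin).
exists t, chi, (fun i x => g i x (+) chi x); split=> // i j.
by rewrite cutD gt tchi addbT negbK eq_sym.
Qed.

End Transversals.

(** * Linked colours *)

Section RainbowTree.
Variables (V I : finType) (O : I -> {set {set V}}).
Hypothesis cardV : #|V| = #|I|.+1.
Hypothesis Oodd : forall i, is_odd_cycle (O i).
Hypothesis Obipartite :
  forall s, transversal O s -> exists g : V -> bool, forall i, cut g (s i).
Variables (t : I -> {set V}) (chi : V -> bool) (h : I -> V -> bool).
Hypothesis tO : transversal O t.
Hypothesis tchi : forall i, cut chi (t i).
Hypothesis th : forall i j, cut (h i) (t j) = (i == j).
Implicit Types (e f m w : {set V}) (i j k l : I) (tau : bool * bool).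
Implicit Types D : {set I}.

Let Ocycle i : is_cycle (O i). Proof. by case: (Oodd i). Qed.

Let O2 i e : e \in O i -> #|e| = 2. Proof. exact: cycle_edge_card. Qed.

Let t2 i : #|t i| = 2. Proof. exact: O2 (tO i). Qed.

(* Equivalently, [e] closes an odd cycle with its tree path. *)
Definition negative e : bool := ~~ cut chi e.

Lemma exists_negative i : exists2 e, e \in O i & negative e.
Proof. exact: odd_cycle_cut. Qed.

Lemma transversal_relation_even (A : {set I}) (s : I -> {set V}) :
  {in A, forall i, s i \in O i} ->
  {in A, forall l, \big[addb/false]_(i in A) cut (h l) (s i) = false} ->
  \big[addb/false]_(i in A) negative (s i) = false.
Proof.
move=> sO relation; pose s' i := if i \in A then s i else t i.
have [|g gs'] := Obipartite (s := s').
  by move=> i; rewrite /s'; case: ifP => // /sO.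
pose g' x := g x (+) chi x.
have g's i : i \in A -> cut g' (s i) = negative (s i).
  by move=> iA; have := gs' i; rewrite /s' iA cutD => ->.
have g't l : l \notin A -> cut g' (t l) = false.
  by move=> lA; have := gs' l; rewrite /s' (negPf lA) cutD tchi => ->.
rewrite -(eq_bigr _ g's) (eq_bigr (fun i =>
  \big[addb/false]_l (cut g' (t l) && cut (h l) (s i)))) => [|i iA]; last first.
  exact: (cut_expand cardV t2 th _ (O2 (sO i iA))).
rewrite exchange_big big1 // => l _; rewrite -big_distrr /=.
by case: (boolP (l \in A)) => [/relation ->|/g't ->]; rewrite ?andbF.
Qed.

Lemma negative_crosses i e : e \in O i -> negative e -> cut (h i) e.
Proof.
move=> eO; apply: contraLR => ei.
have := @transversal_relation_even [set i] (fun=> e).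
rewrite !big_set1 => -> //.
  by move=> _ /set1P->.
by move=> _ /set1P->; rewrite big_set1 (negPf ei).
Qed.

Lemma rainbow_eq_negative i j e f : i != j -> e \in O i -> f \in O j ->
  cut (h i) e = cut (h i) f -> cut (h j) e = cut (h j) f ->
  negative e = negative f.
Proof.
move=> nij eO fO ei ej; suff: negative e (+) negative f = false.
  by case: (negative e); case: (negative f).
pose s l := if l == i then e else f.
have [si sj] : s i = e /\ s j = f by rewrite /s eqxx [j == i]eq_sym (negPf nij).
have sum F : \big[addb/false]_(l in [set i; j]) F (s l) = F e (+) F f.
  by rewrite big_setU1 ?inE //= big_set1 si sj.
rewrite -sum; apply: transversal_relation_even => l.
  by case/set2P=> ->; rewrite ?si ?sj.
by rewrite (sum (cut _)) => /set2P[]->; rewrite ?ei ?ej addbb.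
Qed.

Lemma rainbow_add_negative i j k e f w : i != j -> i != k -> j != k ->
  e \in O i -> f \in O j -> w \in O k ->
  cut (h i) e (+) cut (h i) f = cut (h i) w ->
  cut (h j) e (+) cut (h j) f = cut (h j) w ->
  cut (h k) e (+) cut (h k) f = cut (h k) w ->
  negative e (+) negative f = negative w.
Proof.
move=> nij nik njk eO fO wO hi hj hk.
suff: negative e (+) (negative f (+) negative w) = false.
  by case: (negative e); case: (negative f); case: (negative w).
pose s l := if l == i then e else if l == j then f else w.
have [si sj sk] : [/\ s i = e, s j = f & s k = w].
  rewrite /s !eqxx [j == i]eq_sym [k == i]eq_sym [k == j]eq_sym.
  by rewrite (negPf nij) (negPf nik) (negPf njk).
have sum F : \big[addb/false]_(l in i |: [set j; k]) F (s l)
    = F e (+) (F f (+) F w).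
  by rewrite !big_setU1 ?inE ?negb_or ?nij ?nik //= big_set1 si sj sk.
rewrite -sum; apply: transversal_relation_even => l.
  by rewrite !inE => /or3P[]/eqP->; rewrite ?si ?sj ?sk.
by rewrite (sum (cut _)) addbA !inE => /or3P[]/eqP->; rewrite ?hi ?hj ?hk addbb.
Qed.

Definition negatives_cross i j := [forall e in O i, negative e ==> cut (h j) e].

Definition linked i j := negatives_cross i j && negatives_cross j i.

Lemma negatives_crossP i j :
  reflect {in O i, forall e, negative e -> cut (h j) e} (negatives_cross i j).
Proof.
by apply: (iffP forall_inP) => ij e eO; apply/implyP; apply: ij.
Qed.

Lemma linked_sym i j : linked i j = linked j i.
Proof. exact: andbC. Qed.

Lemma negatives_cross_of_inside i k e :
  e \in O i -> ~~ cut (h i) e -> cut (h k) e -> negatives_cross k i.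
Proof.
move=> eO ei ek; have nik : i != k by apply: contraNneq ei => ->.
apply/negatives_crossP=> f fO fneg; apply: contraNT (ei) => fi.
apply: negative_crosses (eO) _; rewrite (rainbow_eq_negative nik eO fO) //.
  by rewrite (negPf ei) (negPf fi).
by rewrite ek (negative_crosses fO).
Qed.

Lemma crossing_avoids_unlinked i k e : i != k -> negatives_cross k i ->
  ~~ negatives_cross i k -> e \in O i -> cut (h i) e -> ~~ cut (h k) e.
Proof.
move=> nik /negatives_crossP ki; rewrite negb_forall_in => /exists_inP[f fO].
rewrite negb_imply => /andP[fneg fk] eO ei; apply/negP => ek.
have fi := negative_crosses fO fneg.
have [w wO] := odd_cycle_cut
  (fun x => chi x (+) (negative e && h i x)) (Oodd k).
rewrite cutD cutM -addNb -/(negative w) => w_odd.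
have wk : negative w -> cut (h k) w by apply: negative_crosses wO.
have wi : negative w -> cut (h i) w by apply: ki.
have ew : cut (h i) w -> cut (h k) w -> negative e = negative w.
  move=> iw kw; apply: (rainbow_eq_negative nik eO wO).
    by rewrite ei iw.
  by rewrite ek kw.
have fw : cut (h i) w -> ~~ cut (h k) w -> negative f = negative w.
  move=> iw /negPf kw; apply: (rainbow_eq_negative nik fO wO).
    by rewrite fi iw.
  by rewrite (negPf fk) kw.
have [nw|nw] := boolP (negative w).
  by move: w_odd; rewrite (ew (wi nw) (wk nw)) nw wi.
move: w_odd; rewrite (negPf nw) => /andP[ne iw].
case: (boolP (cut (h k) w)) => kw; first by rewrite -(ew iw kw) ne in nw.
by rewrite -(fw iw kw) fneg in nw.
Qed.

Lemma exists_linked i : exists2 j, i != j & linked i j.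
Proof.
apply/exists_inP; apply: contraT; rewrite negb_exists_in => /forall_inP alone.
pose K k := (i != k) && negatives_cross k i.
have insideK e k : e \in O i -> ~~ cut (h i) e -> cut (h k) e -> K k.
  move=> eO ei ek; rewrite /K (negatives_cross_of_inside eO ei ek) andbT.
  by apply: contraNneq ei => ->.
have crossK e k : e \in O i -> cut (h i) e -> K k -> ~~ cut (h k) e.
  move=> eO ei /andP[nik ki]; apply: crossing_avoids_unlinked ei => //.
  by apply: contra (alone k nik) => ik; rewrite /linked ik.
(* All ends of edges of [D] lie on the same side of each [h k] with [K k], while
   the other edges of [O i] move only in these coordinates: [O i] cannot pass
   from [D] to its complement. *)
pose D := [set e in O i | cut (h i) e].
suff ED : D = O i.
  have [e] := odd_cycle_cut (h i) (Oodd i).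
  by rewrite -ED inE => /andP[_ ->].
apply: (cycle_even_subset (Ocycle i)) => [||v].
- by apply/subsetP=> e; rewrite inE => /andP[].
- by apply/set0Pn; exists (t i); rewrite inE tO th eqxx.
have [e0 /andP[/setIdP[e0O e0i] ve0]|none] := pickP [pred e in D | v \in e];
  last first.
  by apply: big1 => e eD; have := none e; rewrite /= eD.
pose g z := [forall k, K k || (h k z == h k v)].
rewrite -[RHS](cycle_cut_even g (Ocycle i)) [RHS](bigID (cut (h i))) /=.
rewrite [X in _ = _ (+) X]big1 => [|e /andP[eO ei]].
  rewrite addbF; apply: eq_big => [e|e]; first by rewrite inE.
  case/setIdP=> eO ei; rewrite -cut_pred1; apply: eq_cut_in => z ze.
  apply/eqP/forallP => [-> k|gz]; first by rewrite eqxx orbT.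
  apply: (vertex_eq cardV t2 th) => k; case: (boolP (K k)) => kK.
    have [nik _] := andP kK.
    by apply: (crossing_same_side cardV t2 th nik (O2 eO) (O2 e0O));
      rewrite ?crossK.
  by have := gz k; rewrite (negPf kK) => /eqP.
apply/negbTE/(cutNP _ (O2 eO)) => x y xe ye; apply: eq_forallb => k.
case: (boolP (K k)) => //= kK; congr (_ == _).
by apply: (cutNP _ (O2 eO)) xe ye; apply: contra kK; apply: insideK.
Qed.

Lemma linked_negative i j e : i != j -> linked i j -> e \in O i :|: O j ->
  negative e = cut (h i) e && cut (h j) e.
Proof.
wlog eO : i j / e \in O i => [sym nij ij|nij /andP[]].
  case/setUP=> eO; [|rewrite andbC]; apply: sym => //.
  - by rewrite inE eO.
  - by rewrite eq_sym.
  - by rewrite linked_sym.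
  - by rewrite inE eO.
move=> /negatives_crossP ij /negatives_crossP ji _.
apply/idP/andP => [en|[ei ej]].
  by split; [apply: negative_crosses | apply: ij].
have [f fO fn] := exists_negative j.
by rewrite (rainbow_eq_negative nij eO fO) // ?ei ?ej ?(ji f) ?negative_crosses.
Qed.

Definition edge_type i j e : bool * bool := (cut (h i) e, cut (h j) e).

(* For [i] and [j] linked and [tau] nonzero, the sign of [e] with respect to the
   tree in which edges of [O i] and [O j] of the two other nonzero types replace
   [t i] and [t j]. *)
Definition switched_sign i j tau e : bool :=
  negative e (+) (~~ tau.2 && cut (h i) e) (+) (~~ tau.1 && cut (h j) e).

Lemma exists_switched_sign i j k tau :
  exists2 e, e \in O k & switched_sign i j tau e.
Proof.
have [e eO] := odd_cycle_cut
  (fun x => chi x (+) (~~ tau.2 && h i x) (+) (~~ tau.1 && h j x)) (Oodd k).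
by rewrite !cutD !cutM -!addNb; exists e.
Qed.

Lemma linked_switched_sign i j tau e :
  i != j -> linked i j -> tau != (false, false) -> e \in O i :|: O j ->
  switched_sign i j tau e = (edge_type i j e == tau).
Proof.
move=> nij ij; case: tau => p q pq eO; rewrite /switched_sign /edge_type.
rewrite (linked_negative nij ij eO); move: pq; rewrite !xpair_eqE /=.
by case: p; case: q; case: (cut (h i) e); case: (cut (h j) e).
Qed.

Lemma switched_sign_eq i j k tau e w :
  i != k -> j != k -> e \in O i :|: O j -> w \in O k ->
  edge_type i j e = edge_type i j w -> cut (h k) e = cut (h k) w ->
  switched_sign i j tau e = switched_sign i j tau w.
Proof.
move=> nik njk eO wO [ei ej] ek; rewrite /switched_sign ei ej.
by case/setUP: eO => eO; congr (_ (+) _ (+) _);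
  apply: rainbow_eq_negative eO wO _ _.
Qed.

Lemma switched_sign_add i j k tau e f w :
  i != j -> i != k -> j != k -> e \in O i -> f \in O j -> w \in O k ->
  cut (h i) e (+) cut (h i) f = cut (h i) w ->
  cut (h j) e (+) cut (h j) f = cut (h j) w ->
  cut (h k) e (+) cut (h k) f = cut (h k) w ->
  switched_sign i j tau e (+) switched_sign i j tau f = switched_sign i j tau w.
Proof.
move=> nij nik njk eO fO wO hi hj hk; rewrite /switched_sign.
rewrite -(rainbow_add_negative nij nik njk eO fO wO hi hj hk).
rewrite -hi -hj !andb_addr.
by rewrite (AC (3*3) ((1*4)*(2*5)*(3*6))).
Qed.

Lemma exists_edge_type i j tau :
  i != j -> linked i j -> tau != (false, false) ->
  (exists2 e, e \in O i & edge_type i j e = tau) /\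
  (exists2 e, e \in O j & edge_type i j e = tau).
Proof.
move=> nij ij nz; have in_class l : l \in [set i; j] ->
    exists2 e, e \in O l & edge_type i j e = tau.
  move=> lij; have [e eO eS] := exists_switched_sign i j l tau; exists e => //.
  apply/eqP; rewrite -(linked_switched_sign nij ij nz) // inE.
  by case/set2P: lij eO => -> ->; rewrite ?orbT.
by split; apply: in_class; rewrite !inE eqxx ?orbT.
Qed.

Definition type_add (tau1 tau2 : bool * bool) : bool * bool :=
  (tau1.1 (+) tau2.1, tau1.2 (+) tau2.2).

Lemma type_addC tau1 tau2 : type_add tau1 tau2 = type_add tau2 tau1.
Proof. by rewrite /type_add addbC [tau1.2 (+) _]addbC. Qed.

Section LinkedTriple.
Variables i j k : I.
Hypotheses (nij : i != j) (nik : i != k) (njk : j != k) (ij : linked i j).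

Lemma switched_cut_neq_add tau w e f : w \in O k -> switched_sign i j tau w ->
  tau != (false, false) -> e \in O i -> f \in O j ->
  edge_type i j e != tau -> edge_type i j f != tau ->
  edge_type i j w = type_add (edge_type i j e) (edge_type i j f) ->
  cut (h k) w != cut (h k) e (+) cut (h k) f.
Proof.
move=> wO wS nz eO fO ne nf [wi wj]; apply/eqP => wk.
have := switched_sign_add tau nij nik njk eO fO wO (esym wi) (esym wj).
move=> /(_ (esym wk)).
by rewrite wS !linked_switched_sign ?inE ?eO ?fO ?orbT // (negPf ne) (negPf nf).
Qed.

Lemma switched_cut_neq tau w e : w \in O k -> switched_sign i j tau w ->
  tau != (false, false) -> e \in O i :|: O j -> edge_type i j e != tau ->
  edge_type i j w = edge_type i j e -> cut (h k) w != cut (h k) e.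
Proof.
move=> wO wS nz eO ne we; apply/eqP => wk.
have := switched_sign_eq tau nik njk eO wO (esym we) (esym wk).
by rewrite wS linked_switched_sign // (negPf ne).
Qed.

Lemma switched_inside_crosses tau w : w \in O k -> switched_sign i j tau w ->
  edge_type i j w = (false, false) -> cut (h k) w.
Proof.
move=> wO; rewrite /switched_sign => wS [wi wj]; apply: negative_crosses => //.
by move: wS; rewrite wi wj !andbF !addbF.
Qed.

(* Otherwise an edge of [O k] whose switched sign for the third type is 1 would
   have none of the four possible types. *)
Lemma linked_types_both_sides tau0 tau e f b : e \in O i -> f \in O j ->
  edge_type i j e = tau0 -> edge_type i j f = tau0 ->
  cut (h k) e != cut (h k) f ->
  tau0 != (false, false) -> tau != (false, false) -> tau != tau0 ->
  exists w, [/\ #|w| = 2, edge_type i j w = tau & cut (h k) w = b].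
Proof.
move=> eO fO e_tau0 f_tau0 ef nz0 nz ne.
have [[a aO a_tau] [a' a'O a'_tau]] := exists_edge_type nij ij nz.
have [<-|ab] := eqVneq (cut (h k) a) b; first by exists a; rewrite (O2 aO).
have [<-|a'b] := eqVneq (cut (h k) a') b; first by exists a'; rewrite (O2 a'O).
pose third := type_add tau0 tau.
have [nz3 n03 n3] : [/\ third != (false, false), tau0 != third & tau != third].
  by rewrite /third; move: nz0 nz ne; case: (tau0) (tau) => [[] []] [[] []].
have [w wO wS] := exists_switched_sign i j k third.
have neq_w := switched_cut_neq wO wS nz3.
have neq_add_w := switched_cut_neq_add wO wS nz3.
have : edge_type i j w \in [:: (false, false); tau0; tau; third].
  rewrite /third; move: nz0 nz ne; case: (edge_type i j w) => [[] []];
  by case: (tau0) (tau) => [[] []] [[] []].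
rewrite !inE => /or4P[]/eqP w_tau.
- have wef : cut (h k) w != cut (h k) e (+) cut (h k) f.
    by apply: neq_add_w; rewrite // ?e_tau0 ?f_tau0 // w_tau /type_add !addbb.
  move: ef wef; rewrite (switched_inside_crosses wO wS w_tau).
  by case: (cut (h k) e); case: (cut (h k) f).
- have we : cut (h k) w != cut (h k) e.
    by apply: neq_w; rewrite ?inE ?eO ?e_tau0.
  have wf : cut (h k) w != cut (h k) f.
    by apply: neq_w; rewrite ?inE ?fO ?orbT ?f_tau0.
  move: ef we wf.
  by case: (cut (h k) e); case: (cut (h k) f); case: (cut (h k) w).
- exists w; split; rewrite ?(O2 wO) //.
  have wa : cut (h k) w != cut (h k) a.
    by apply: neq_w; rewrite ?inE ?aO ?a_tau.
  by move: ab wa; case: (cut (h k) a); case: (cut (h k) w); case: b {a'b}.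
have wea' : cut (h k) w != cut (h k) e (+) cut (h k) a'.
  by apply: neq_add_w; rewrite ?e_tau0 ?a'_tau.
have waf : cut (h k) w != cut (h k) a (+) cut (h k) f.
  by apply: neq_add_w; rewrite ?a_tau ?f_tau0 // type_addC.
move: ef waf wea' ab a'b.
case: (cut (h k) a); case: (cut (h k) a'); case: b => //;
  by case: (cut (h k) e); case: (cut (h k) f); case: (cut (h k) w).
Qed.

Lemma no_fano_types :
  (forall tau, tau != (false, false) ->
     exists w, [/\ #|w| = 2, edge_type i j w = tau & cut (h k) w]) ->
  forall e, #|e| = 2 -> edge_type i j e = (true, true) -> cut (h k) e.
Proof.
move=> far e e2 [ei ej]; apply: contraT => /negbTE ek.
have [w_i [i2 [ii ij'] ik]] := far (true, false) isT.
have [w_j [j2 [ji jj] jk]] := far (false, true) isT.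
have [w [w2 [wi wj] wk]] := far (true, true) isT.
by case: (no_fano_edges cardV t2 th nij nik njk e2 i2 j2 w2);
  rewrite ?ei ?ej ?ek ?ii ?ij' ?ik ?ji ?jj ?jk ?wi ?wj ?wk.
Qed.

Lemma linked_same_side e f : e \in O i -> f \in O j ->
  edge_type i j e = edge_type i j f -> edge_type i j e != (false, false) ->
  cut (h k) e = cut (h k) f.
Proof.
move=> eO fO ef nz; apply/eqP; apply: contraT => split_ef.
have both tau b : tau != (false, false) ->
    exists w, [/\ #|w| = 2, edge_type i j w = tau & cut (h k) w = b].
  move=> nz'; have [-> {tau nz'}|] := eqVneq tau (edge_type i j e); last first.
    exact: (linked_types_both_sides _ eO fO).
  have [<-|eb] := eqVneq (cut (h k) e) b; first by exists e; rewrite (O2 eO).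
  exists f; rewrite (O2 fO); split=> //.
  by move: split_ef eb; case: (cut (h k) e); case: (cut (h k) f); case: b.
have [w [w2 w_tau wk]] := both (true, true) false isT.
by have := no_fano_types (both ^~ true) w2 w_tau; rewrite wk.
Qed.

End LinkedTriple.

Lemma linked_edge_eq i j e f : i != j -> linked i j -> e \in O i -> f \in O j ->
  edge_type i j e = edge_type i j f -> edge_type i j e != (false, false) ->
  e = f.
Proof.
move=> nij ij eO fO ef nz; have [ei ej] := ef.
apply: (edge_eq cardV t2 th (O2 eO) (O2 fO)) => k.
have [<-//|nik] := eqVneq i k; have [<-//|njk] := eqVneq j k.
exact: linked_same_side ef nz.
Qed.

Lemma linked_shared_edge i j e : i != j -> linked i j ->
  edge_type i j e != (false, false) -> (e \in O i) = (e \in O j).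
Proof.
move=> nij ij nz.
have [[f fO f_tau] [f' f'O f'_tau]] := exists_edge_type nij ij nz.
apply/idP/idP => eO; first by rewrite (linked_edge_eq nij ij eO f'O) ?f'_tau.
by rewrite -(linked_edge_eq nij ij fO eO) ?f_tau.
Qed.

Lemma negative_edge_type i j e : i != j -> linked i j -> e \in O i ->
  negative e -> edge_type i j e = (true, true).
Proof.
move=> nij ij eO; rewrite (linked_negative nij ij) ?inE ?eO // => /andP[ei ej].
by rewrite /edge_type ei ej.
Qed.

Lemma negative_unique i e f :
  e \in O i -> f \in O i -> negative e -> negative f -> e = f.
Proof.
move=> eO fO en fn; have [j nij ij] := exists_linked i.
have e_tau := negative_edge_type nij ij eO en.
have f_tau := negative_edge_type nij ij fO fn.
apply: (linked_edge_eq nij ij eO); rewrite ?e_tau ?f_tau //.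
by rewrite -(linked_shared_edge nij ij) ?f_tau.
Qed.

Lemma linked_common_edge i j k m tau :
  i != j -> i != k -> j != k -> linked i j ->
  m \in O i -> negative m -> ~~ cut (h k) m -> tau != (false, false) ->
  exists c, [/\ c \in O i, c \in O j, edge_type i j c = tau & ~~ cut (h k) c].
Proof.
move=> nij nik njk ij mO mn mk nz.
have shared := linked_shared_edge nij ij.
have m_tau := negative_edge_type nij ij mO mn.
have ti_tau : edge_type i j (t i) = (true, false).
  by rewrite /edge_type !th eqxx eq_sym (negPf nij).
have tj_tau : edge_type i j (t j) = (false, true).
  by rewrite /edge_type !th eqxx (negPf nij).
case: tau nz => [[] []] // _.
- by exists m; split; rewrite // -shared ?m_tau.
- by exists (t i); split; rewrite -?shared ?ti_tau // th eq_sym.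
by exists (t j); split; rewrite ?shared ?tj_tau // th eq_sym.
Qed.

(* Otherwise, for each nonzero [tau], the edges of [O k] with switched sign 1
   have type [tau] and cross [h k]. *)
Lemma linked_inside_crossing i j k e m :
  i != j -> i != k -> j != k -> linked i j -> e \in O i ->
  edge_type i j e = (false, false) -> cut (h k) e ->
  m \in O i -> negative m -> cut (h k) m.
Proof.
move=> nij nik njk ij eO e_in ek mO mn; apply: contraT => mk.
have common := linked_common_edge nij nik njk ij mO mn mk.
suff far : forall tau, tau != (false, false) ->
    exists w, [/\ #|w| = 2, edge_type i j w = tau & cut (h k) w].
  have m_tau := negative_edge_type nij ij mO mn.
  by have := no_fano_types nij nik njk far (O2 mO) m_tau; rewrite (negPf mk).
move=> tau nz; have [w wO wS] := exists_switched_sign i j k tau.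
have neq_w := switched_cut_neq nij nik njk ij wO wS nz.
have neq_add_w := switched_cut_neq_add nij nik njk ij wO wS nz.
exists w; rewrite (O2 wO).
have [w_in|w_nz] := eqVneq (edge_type i j w) (false, false).
  have := neq_w e; rewrite inE eO e_in ek (switched_inside_crosses wO wS w_in).
  by rewrite eq_sym => /(_ isT nz w_in).
have w_tau : edge_type i j w = tau.
  apply/eqP; apply: contraT => w_ntau.
  have [c [ci cj c_tau ck]] := common _ w_nz.
  have wc : cut (h k) w != cut (h k) c.
    by apply: neq_w; rewrite ?inE ?ci ?c_tau.
  have : cut (h k) w != cut (h k) e (+) cut (h k) c.
    by apply: neq_add_w; rewrite ?e_in ?c_tau // eq_sym.
  by move: wc; rewrite ek (negPf ck); case: (cut (h k) w).
split=> //; have [tau1 [nz1 nz2 ne1 ne2]] : exists tau1,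
    [/\ tau1 != (false, false), type_add tau1 tau != (false, false),
        tau1 != tau & type_add tau1 tau != tau].
  by exists (tau.2, tau.1 (+) tau.2); case: (tau) nz => [[] []].
have [c [ci _ c_tau ck]] := common _ nz1.
have [d [_ dj d_tau dk]] := common _ nz2.
have : cut (h k) w != cut (h k) c (+) cut (h k) d.
  apply: neq_add_w; rewrite ?c_tau ?d_tau // w_tau.
  by case: (tau) (tau1) => [[] []] [[] []].
by rewrite (negPf ck) (negPf dk); case: (cut (h k) w).
Qed.

(** * Blocks *)

Lemma positive_edge i e : e \in O i -> ~~ negative e ->
  exists2 l, e = t l & (i == l) || linked i l.
Proof.
move=> eO ep; have outer l : i != l -> linked i l -> ~~ cut (h i) e ->
    cut (h l) e -> exists2 l, e = t l & (i == l) || linked i l.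
  move=> nil il /negbTE ei el; exists l; last by rewrite il orbT.
  by apply: (linked_edge_eq nil il eO (tO l));
    rewrite /edge_type ?th ?eqxx ei el ?(negPf nil).
have [j nij ij] := exists_linked i.
have := linked_negative nij ij (_ : e \in O i :|: O j).
rewrite inE eO (negPf ep) => /(_ isT)/esym/negbT e_ij.
case: (boolP (cut (h i) e)) => ei.
  have ej : cut (h j) e = false by move: e_ij; rewrite ei => /negbTE.
  exists i; rewrite ?eqxx //; apply/esym; apply: (linked_edge_eq nij ij (tO i)).
  - by rewrite -(linked_shared_edge nij ij) // /edge_type ei.
  - by rewrite /edge_type !th eqxx [j == i]eq_sym (negPf nij) ei ej.
  by rewrite /edge_type !th eqxx.
case: (boolP (cut (h j) e)) => ej; first exact: outer ij ei ej.
have [k ek] := edge_crosses cardV t2 th (O2 eO).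
have nik : i != k by apply: contraNneq ei => ->.
have njk : j != k by apply: contraNneq ej => ->.
apply: (outer k nik _ ei ek); rewrite /linked (negatives_cross_of_inside eO) //.
rewrite andbT; apply/negatives_crossP => m mO mn.
apply: linked_inside_crossing nij nik njk ij eO _ ek mO mn.
by rewrite /edge_type (negPf ei) (negPf ej).
Qed.

Lemma tree_edge_inj : injective t.
Proof. by move=> l l' tl; apply/eqP; rewrite -th -tl th. Qed.

Lemma cycle_of_negative i m : m \in O i -> negative m ->
  O i = m |: t @: [set l | cut (h l) m].
Proof.
move=> mO mn; apply/setP=> e; rewrite in_setU1.
have crosses_m l : (i == l) || linked i l -> cut (h l) m.
  case/predU1P=> [<-|/andP[/negatives_crossP il _]]; last exact: il.
  exact: negative_crosses mO mn.
apply/idP/predU1P => [eO|[->//|/imsetP[l]]].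
  have [en|/(positive_edge eO)[l -> il]] := boolP (negative e); [left|right].
    exact: negative_unique eO mO en mn.
  by apply: imset_f; rewrite inE crosses_m.
rewrite inE => lm ->; apply: contraT => ntl.
have := cycle_cut_even (h l) (Ocycle i).
rewrite (bigD1 m) //= lm big1 // => f /andP[fO nfm]; apply: contraNF ntl => lf.
have [fn|/(positive_edge fO)[l' f_t _]] := boolP (negative f).
  by case/eqP: nfm; apply: negative_unique fO mO fn mn.
by move: lf fO; rewrite f_t th => /eqP->.
Qed.

Lemma tree_edge_cycle i l : t l \in O i -> O l = O i.
Proof.
move=> tlO; have := positive_edge tlO; rewrite /negative tchi => -[] // l'.
move=> /tree_edge_inj <- /predU1P[->//|il]; have [<-//|nil] := eqVneq i l.
have [m mO mn] := exists_negative i.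
have mOl : m \in O l.
  by rewrite -(linked_shared_edge nil il) // (negative_edge_type nil il mO mn).
by rewrite (cycle_of_negative mO mn) (cycle_of_negative mOl mn).
Qed.

Definition block i : {set I} := [set l | O l == O i].

Lemma card_cycle_block i : #|O i| = #|block i|.+1.
Proof.
have [m mO mn] := exists_negative i; have Oi := cycle_of_negative mO mn.
have -> : block i = [set l | cut (h l) m].
  apply/setP=> l; rewrite !inE; apply/eqP/idP => [Ol|lm].
    by apply: negative_crosses mn; rewrite Ol.
  by apply: tree_edge_cycle; rewrite Oi setU1r // imset_f // inE.
rewrite Oi cardsU1 card_imset; last exact: tree_edge_inj.
suff -> : m \notin t @: [set l | cut (h l) m] by [].
by apply: contraL mn => /imsetP[l _ ->]; rewrite /negative tchi.
Qed.

Definition family (D : {set I}) := [seq O i | i <- enum D].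
Definition vertices (D : {set I}) := \bigcup_(i in D) cover (O i).

Lemma cover_family D : cover (union_graph (family D)) = vertices D.
Proof.
rewrite /union_graph /family big_map big_enum /=; apply/setP=> x.
apply/bigcupP/bigcupP => [[e /bigcupP[i iD ei] xe]|[i iD /bigcupP[e ei xe]]].
  by exists i => //; apply/bigcupP; exists e.
by exists e => //; apply/bigcupP; exists i.
Qed.

Lemma tree_edge_sub_vertices D l : l \in D -> t l \subset vertices D.
Proof.
by move=> lD; apply: bigcup_max lD _; apply: bigcup_max (tO l) _.
Qed.

Lemma vertices_block i : vertices (block i) = cover (O i).
Proof.
apply/setP=> x; apply/bigcupP/idP => [[j]|xi]; first by rewrite inE => /eqP->.
by exists i; rewrite ?inE.
Qed.

Lemma card_vertices_block i : #|vertices (block i)| = #|block i|.+1.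
Proof. by rewrite vertices_block card_cover_cycle ?card_cycle_block. Qed.

(** * Gluing the blocks *)

(* The vertex count says that the edges [t i] with [i] in [D] form a tree. *)
Definition partial_cactus (D : {set I}) : Prop :=
  [/\ {in D, forall i, block i \subset D}, #|vertices D| = #|D|.+1
    & pruned_cactus (family D)].

Lemma partial_cactus_block i : partial_cactus (block i).
Proof.
split; [|exact: card_vertices_block|].
  by move=> j; rewrite inE => /eqP ji; apply/subsetP=> l; rewrite !inE ji.
apply: (@pruned_cactus_cycle _ _ (O i)) => [//||C /mapP[j]].
  by rewrite -vertices_block card_vertices_block size_map -cardE.
by rewrite mem_enum inE => /eqP-> ->.
Qed.

Lemma exists_touching_cycle D : partial_cactus D -> D != setT ->
  exists2 i, i \notin D & vertices D :&: cover (O i) != set0.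
Proof.
case=> _ cardD _ nDT; apply/exists_inP; apply: contraT.
rewrite negb_exists_in => /forall_inP away.
have const : forall x y, (x \in vertices D) = (y \in vertices D).
  apply: (tree_connected cardV t2 th (g := mem (vertices D))) => l.
  apply/(cutNP _ (t2 l)) => x y xl yl; rewrite !topredE.
  case: (boolP (l \in D)) => lD.
    by rewrite !(subsetP (tree_edge_sub_vertices lD)).
  have /negPn/eqP/setP far := away l lD.
  have in_l z : z \in t l -> z \in cover (O l).
    by apply: subsetP; apply: bigcup_max (tO l) _.
  by move: (far x) (far y); rewrite !inE !in_l // !andbT => -> ->.
have /set0Pn[x xD] : vertices D != set0 by rewrite -card_gt0 cardD.
have vT : vertices D = setT by apply/setP=> y; rewrite (const y x) inE.
case/eqP: nDT; apply/eqP; rewrite eqEcard subsetT cardsT -ltnS -cardD.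
by rewrite vT cardsT cardV /=.
Qed.

Lemma partial_cactus_disjoint_block D i :
  partial_cactus D -> i \notin D -> D :&: block i = set0.
Proof.
case=> clD _ _ niD; apply/setP=> j; rewrite in_setI in_set0.
apply: contraNF niD => /andP[/clD/subsetP jD]; rewrite inE => /eqP ji.
by apply: jD; rewrite inE ji.
Qed.

(* The tree edges of [D] and of the block form a forest, so that the vertex sets
   cannot share more than one vertex. *)
Lemma partial_cactus_card_block D i : partial_cactus D -> i \notin D ->
  vertices D :&: cover (O i) != set0 ->
  #|vertices D :&: cover (O i)| = 1 /\
  #|vertices (D :|: block i)| = #|D :|: block i|.+1.
Proof.
move=> pcD niD; rewrite -vertices_block -card_gt0 => meet0.
have [_ cardD _] := pcD; have disj := partial_cactus_disjoint_block pcD niD.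
have vD' : vertices (D :|: block i) = vertices D :|: vertices (block i).
  exact: bigcup_setU.
have cardD' : #|D :|: block i| = #|D| + #|block i|.
  by rewrite cardsU disj cards0 subn0.
have : #|D :|: block i| < #|vertices (D :|: block i)|.
  apply: (card_tree_edges t2 th) => [|l]; last exact: tree_edge_sub_vertices.
  by rewrite vD' setU_eq0 negb_and -card_gt0 cardD.
have := cardsUI (vertices D) (vertices (block i)).
rewrite -vD' cardD card_vertices_block cardD'; lia.
Qed.

Lemma partial_cactus_add_block D i : partial_cactus D -> i \notin D ->
  vertices D :&: cover (O i) != set0 -> partial_cactus (D :|: block i).
Proof.
move=> pcD niD touch.
have [meet1 cardD'] := partial_cactus_card_block pcD niD touch.
have disj := partial_cactus_disjoint_block pcD niD.
have [[clD _ pD] [clB _ pB]] := (pcD, partial_cactus_block i).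
split=> // [j /setUP[/clD jD|/clB jB]|].
- exact: subset_trans jD (subsetUl _ _).
- exact: subset_trans jB (subsetUr _ _).
apply: (@pruned_cactus_join _ _ (family D) (family (block i))) => //;
  last first.
  by rewrite !cover_family vertices_block.
rewrite -map_cat; apply: perm_map; apply: uniq_perm; rewrite ?enum_uniq //.
  rewrite cat_uniq !enum_uniq andbT /=; apply/hasPn=> j.
  rewrite !mem_enum => jB.
  by apply/negP=> jD; have /setP/(_ j) := disj; rewrite inE jD jB inE.
by move=> j; rewrite mem_cat !mem_enum in_setU.
Qed.

Lemma partial_cactus_setT (i : I) : partial_cactus setT.
Proof.
suff grow (d : nat) D : #|~: D| < d -> partial_cactus D -> partial_cactus setT.
  exact: (grow _ _ (ltnSn _) (partial_cactus_block i)).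
elim: d D => // d IH D; rewrite ltnS => leDd pcD.
have [<-//|nDT] := eqVneq D setT.
have [j njD touch] := exists_touching_cycle pcD nDT.
apply: IH (partial_cactus_add_block pcD njD touch); apply: leq_trans leDd.
apply: proper_card; apply/properP; split; first by rewrite setCS subsetUl.
by exists j; rewrite !inE // eqxx orbT.
Qed.

End RainbowTree.

Lemma pruned_cactus_of_bipartite_transversals (V I : finType)
    (O : I -> {set {set V}}) :
  #|V| = #|I|.+1 -> 0 < #|I| -> (forall i, is_odd_cycle (O i)) ->
  (forall s, transversal O s -> exists g : V -> bool, forall i, cut g (s i)) ->
  pruned_cactus [seq O i | i <- enum I].
Proof.
move=> cardV /card_gt0P[i _] Oodd Obip.
have [t [chi [h [tO tchi th]]]] := exists_rainbow_tree Oodd Obip.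
have [_ _] := partial_cactus_setT cardV Oodd Obip tO tchi th i.
by rewrite /family enum_setT -enumT.
Qed.

Lemma rainbow_of_transversal (V : finType) (O : seq {set {set V}})
    (s : 'I_(size O) -> {set V}) (C : {set {set V}}) :
  transversal (fun i : 'I_(size O) => nth set0 O i) s ->
  C \subset s @: setT -> rainbow O C.
Proof.
move=> sO sC; have sP e : e \in C -> exists i, s i = e.
  by move=> /(subsetP sC)/imsetP[i _ ->]; exists i.
split.
  apply/subsetP=> e /sP[i <-]; rewrite /union_graph (big_nth set0) big_mkord.
  by apply/bigcupP; exists i.
pose sigma e := if [pick i | s i == e] is Some i then nat_of_ord i else 0.
have sigmaP e : e \in C -> exists2 i, sigma e = nat_of_ord i & s i = e.
  rewrite /sigma; case: pickP => [i /eqP <- _|none /sP[i si]].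
    by exists i.
  by have := none i; rewrite si eqxx.
exists sigma; split=> [e e' /sigmaP[i -> <-] /sigmaP[i' -> <-] /ord_inj->//|e].
by case/sigmaP=> i -> <-.
Qed.

Lemma bipartite_transversal (V : finType) (O : seq {set {set V}})
    (s : 'I_(size O) -> {set V}) :
  (forall C, C \in O -> is_cycle C) -> ~ has_rainbow_odd_cycle O ->
  transversal (fun i : 'I_(size O) => nth set0 O i) s ->
  exists g : V -> bool, forall i, cut g (s i).
Proof.
move=> Ocycle noR sO.
have [_ /imsetP[i _ ->]|C sC oddC|g gP] :=
  @bipartite_of_no_odd_cycle V (s @: setT).
- exact: cycle_edge_card (Ocycle _ (mem_nth set0 (ltn_ord i))) (sO i).
- by apply: noR; exists C; split=> //; apply: rainbow_of_transversal sO sC.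
by exists g => i; apply: gP; apply: imset_f.
Qed.

Theorem theorem2p3 (n : nat) (hn : 0 < n) (O : seq {set {set 'I_n.+1}})
    (hsize : size O = n)
    (hodd : forall C, C \in O -> is_odd_cycle C)
    (hrainbow : ~ has_rainbow_odd_cycle O) :
  pruned_cactus O.
Proof.
have <- : [seq nth set0 O (val i) | i <- enum 'I_(size O)] = O.
  by rewrite -[RHS](mkseq_nth set0) /mkseq -val_enum_ord -map_comp.
apply: pruned_cactus_of_bipartite_transversals => [||i|s].
- by rewrite !card_ord hsize.
- by rewrite card_ord hsize.
- by apply: hodd; apply: mem_nth; apply: ltn_ord.
by apply: bipartite_transversal hrainbow => C /hodd[].
Qed.
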